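(* Let $p:\mathscr{E}\to\mathscr{B}$ be a functor equipped with a comprehension structure with section, i.e. a section $\star:\mathscr{B}\to\mathscr{E}$ of $p$ with right adjoint $[-]:\mathscr{E}\to\mathscr{B}$. Let $F:\mathscr{B}\to\mathscr{B}$ and $G:\mathscr{E}\to\mathscr{E}$ be endofunctors, and let $\delta:F\circ p\Rightarrow p\circ G$ and $\sigma:G\circ\star\Rightarrow\star\circ F$ be natural transformations such that (1) the composite $F=F\circ p\circ\star\xRightarrow{\ \delta\circ\star\ }p\circ G\circ\star\xRightarrow{\ p\circ\sigma\ }p\circ\star\circ F=F$ is the identity, and (2) $\sigma$ is invertible. Then the comprehension structure with section $\star:\mathscr{B}\to\mathscr{E}$ lifts to a comprehension structure with section $\star:\mathbf{Alg}_F(\mathscr{B})\to\mathbf{Alg}_G(\mathscr{E})$ on the functor $\mathbf{Alg}(p):\mathbf{Alg}_G(\mathscr{E})\to\mathbf{Alg}_F(\mathscr{B})$: the lifted functor $\star$ is a section of $\mathbf{Alg}(p)$ and is left adjoint to the lifted comprehension functor $[-]:\mathbf{Alg}_G(\mathscr{E})\to\mathbf{Alg}_F(\mathscr{B})$. Consequently, if the initial $F$-algebra $\mu F$ exists, then $\star$ transports it to the initial $G$-algebra: $\mu G=\star_{\mu F}$.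
   Context: A section of $p:\mathscr{E}\to\mathscr{B}$ is a functor $\star:\mathscr{B}\to\mathscr{E}$, $A\mapsto\star_A$, with $p\circ\star=\mathrm{id}_{\mathscr{B}}$. A comprehension structure with section on $p$ is a section of $p$ together with a right adjoint of that section. For an endofunctor $F$ on $\mathscr{B}$, $\mathbf{Alg}_F(\mathscr{B})$ is the category of $F$-algebras $(A,a:FA\to A)$ and algebra morphisms; similarly $\mathbf{Alg}_G(\mathscr{E})$. The functor $\mathbf{Alg}(p)$ sends a $G$-algebra $(R,r:GR\to R)$ to $(pR,\ p(r)\circ\delta_R:FpR\to pR)$ and acts as $p$ on morphisms. The lifted section sends an $F$-algebra $(A,a)$ to $(\star_A,\ \star_a\circ\sigma_A:G\star_A\to\star_A)$ and acts as $\star$ on morphisms. The lifted comprehension functor sends $(R,r)$ to $([R],\ [r]\circ\widetilde{\sigma}_R:F[R]\to[R])$ and acts as $[-]$ on morphisms, where $\widetilde{\sigma}:F\circ[-]\Rightarrow[-]\circ G$ is the mate of $\sigma^{-1}$, i.e. the composite $$F[-]\xRightarrow{\ \eta\ }[\star F[-]]\xRightarrow{\ [\sigma^{-1}]\ }[G\star[-]]\xRightarrow{\ [G\varepsilon]\ }[G(-)],$$ with $\eta,\varepsilon$ the unit and counit of $\star\dashv[-]$. *)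

(* Defs.v *)
From Stdlib Require Import ProofIrrelevance.

Set Implicit Arguments.
Unset Strict Implicit.
Unset Printing Implicit Defensive.

Declare Scope cat_scope.
Delimit Scope cat_scope with cat.
Local Open Scope cat_scope.

Record category : Type := Category {
  ob :> Type;
  hom : ob -> ob -> Type;
  idm : forall A : ob, hom A A;
  comp : forall A B C : ob, hom B C -> hom A B -> hom A C;
  comp_idl : forall (A B : ob) (f : hom A B), comp (idm B) f = f;
  comp_idr : forall (A B : ob) (f : hom A B), comp f (idm A) = f;
  comp_assoc : forall (A B C D : ob)
    (h : hom C D) (g : hom B C) (f : hom A B),
    comp h (comp g f) = comp (comp h g) f
}.

Arguments hom {c} A B : rename.
Arguments idm {c} A : rename.
Arguments comp {c A B C} g f : rename.

Notation "g \o f" := (comp g f) (at level 50, left associativity) : cat_scope.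

Record functor (C D : category) : Type := Functor {
  fob :> C -> D;
  fmap : forall A B : C, hom A B -> hom (fob A) (fob B);
  fmap_id : forall A : C, fmap (idm A) = idm (fob A);
  fmap_comp : forall (A B X : C) (g : hom B X) (f : hom A B),
    fmap (g \o f) = fmap g \o fmap f
}.

Arguments fmap {C D} F {A B} f : rename.

Definition fid (C : category) : functor C C :=
  @Functor C C (fun A => A) (fun A B f => f)
    (fun A => eq_refl) (fun A B X g f => eq_refl).

Section FunctorComposition.
Variables (C D E : category) (G : functor D E) (F : functor C D).

Lemma fcomp_id (A : C) : fmap G (fmap F (idm A)) = idm (G (F A)).
Proof. now rewrite !fmap_id. Qed.

Lemma fcomp_comp (A B X : C) (g : hom B X) (f : hom A B) :
  fmap G (fmap F (g \o f)) = fmap G (fmap F g) \o fmap G (fmap F f).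
Proof. now rewrite !fmap_comp. Qed.

Definition fcomp : functor C E :=
  @Functor C E (fun A => G (F A)) (fun A B f => fmap G (fmap F f))
    fcomp_id fcomp_comp.

End FunctorComposition.

Notation "G \O F" := (fcomp G F) (at level 50, left associativity) : cat_scope.

Record nat_trans (C D : category) (F G : functor C D) : Type := NatTrans {
  nt :> forall A : C, hom (F A) (G A);
  nt_nat : forall (A B : C) (f : hom A B),
    nt B \o fmap F f = fmap G f \o nt A
}.

Lemma nt_id_nat (C D : category) (F : functor C D) (A B : C) (f : hom A B) :
  idm (F B) \o fmap F f = fmap F f \o idm (F A).
Proof. now rewrite comp_idl, comp_idr. Qed.

Definition nt_id (C D : category) (F : functor C D) : nat_trans F F :=
  @NatTrans C D F F (fun A => idm (F A)) (nt_id_nat F).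

(* An equality of functors, read as the identity natural transformation
   between its two sides. *)
Definition nt_eq (C D : category) (F G : functor C D) (e : F = G) :
    nat_trans F G :=
  match e in _ = H return nat_trans F H with eq_refl => nt_id F end.

Record nt_inverse (C D : category) (F G : functor C D)
    (s : nat_trans F G) : Type := NtInverse {
  nt_inv :> nat_trans G F;
  nt_inv_l : forall A : C, nt_inv A \o s A = idm (F A);
  nt_inv_r : forall A : C, s A \o nt_inv A = idm (G A)
}.

Record adjunction (C D : category) (L : functor C D) (R : functor D C) :
    Type := Adjunction {
  unit : nat_trans (fid C) (R \O L);
  counit : nat_trans (L \O R) (fid D);
  triangle_l : forall A : C, counit (L A) \o fmap L (unit A) = idm (L A);
  triangle_r : forall X : D, fmap R (counit X) \o unit (R X) = idm (R X)
}.

Definition is_section (E B : category) (p : functor E B) (s : functor B E) :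
  Prop := p \O s = fid B.

Record comprehension_with_section (E B : category) (p : functor E B) :
    Type := ComprehensionWithSection {
  star : functor B E;
  star_section : is_section p star;
  compr : functor E B;
  star_compr_adj : adjunction star compr
}.

Definition is_initial (C : category) (X : C) : Prop :=
  forall Y : C, exists f : hom X Y, forall g : hom X Y, g = f.

Section Algebras.
Variables (C : category) (F : functor C C).

Record algebra : Type := Algebra {
  carrier : C;
  action : hom (F carrier) carrier
}.

Record alg_hom (X Y : algebra) : Type := AlgHom {
  alg_map : hom (carrier X) (carrier Y);
  alg_map_action : alg_map \o action X = action Y \o fmap F alg_map
}.

Lemma alg_hom_eq (X Y : algebra) (f g : alg_hom X Y) :
  alg_map f = alg_map g -> f = g.
Proof.
destruct f as [f hf], g as [g hg]; simpl; intro e; subst g.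
now rewrite (proof_irrelevance _ hf hg).
Qed.

Lemma alg_id_action (X : algebra) :
  idm (carrier X) \o action X = action X \o fmap F (idm (carrier X)).
Proof. now rewrite fmap_id, comp_idl, comp_idr. Qed.

Lemma alg_comp_action (X Y Z : algebra) (g : alg_hom Y Z) (f : alg_hom X Y) :
  alg_map g \o alg_map f \o action X
  = action Z \o fmap F (alg_map g \o alg_map f).
Proof.
now rewrite <- comp_assoc, alg_map_action, comp_assoc, alg_map_action,
  fmap_comp, comp_assoc.
Qed.

Definition alg_id (X : algebra) : alg_hom X X := AlgHom (alg_id_action X).

Definition alg_comp (X Y Z : algebra) (g : alg_hom Y Z) (f : alg_hom X Y) :
  alg_hom X Z := AlgHom (alg_comp_action g f).

Lemma alg_comp_idl (X Y : algebra) (f : alg_hom X Y) :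
  alg_comp (alg_id Y) f = f.
Proof. apply alg_hom_eq, comp_idl. Qed.

Lemma alg_comp_idr (X Y : algebra) (f : alg_hom X Y) :
  alg_comp f (alg_id X) = f.
Proof. apply alg_hom_eq, comp_idr. Qed.

Lemma alg_comp_assoc (X Y Z W : algebra)
    (h : alg_hom Z W) (g : alg_hom Y Z) (f : alg_hom X Y) :
  alg_comp h (alg_comp g f) = alg_comp (alg_comp h g) f.
Proof. apply alg_hom_eq, comp_assoc. Qed.

Definition Alg : category :=
  @Category algebra alg_hom alg_id alg_comp
    alg_comp_idl alg_comp_idr alg_comp_assoc.

End Algebras.

(* [H : C -> D] with [theta : G H => H F] induces the functor
   (A, a) |-> (H A, H a \o theta A) from F-algebras to G-algebras. *)
Section AlgebraLifting.
Variables (C D : category) (F : functor C C) (G : functor D D).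
Variables (H : functor C D) (theta : nat_trans (G \O H) (H \O F)).

Definition alg_lift_ob (X : Alg F) : Alg G :=
  @Algebra D G (H (carrier X)) (fmap H (action X) \o theta (carrier X)).

Lemma alg_lift_action (X Y : Alg F) (f : hom X Y) :
  fmap H (alg_map f) \o action (alg_lift_ob X)
  = action (alg_lift_ob Y) \o fmap G (fmap H (alg_map f)).
Proof.
simpl; rewrite comp_assoc, <- fmap_comp, alg_map_action, fmap_comp.
rewrite <- !comp_assoc; f_equal.
symmetry; exact (nt_nat theta (alg_map f)).
Qed.

Definition alg_lift_map (X Y : Alg F) (f : hom X Y) :
  hom (alg_lift_ob X) (alg_lift_ob Y) :=
  @AlgHom D G (alg_lift_ob X) (alg_lift_ob Y) (fmap H (alg_map f))
    (alg_lift_action f).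

Lemma alg_lift_id (X : Alg F) : alg_lift_map (idm X) = idm (alg_lift_ob X).
Proof. apply alg_hom_eq, fmap_id. Qed.

Lemma alg_lift_comp (X Y Z : Alg F) (g : hom Y Z) (f : hom X Y) :
  alg_lift_map (g \o f) = alg_lift_map g \o alg_lift_map f.
Proof. apply alg_hom_eq, fmap_comp. Qed.

Definition alg_lift : functor (Alg F) (Alg G) :=
  @Functor (Alg F) (Alg G) alg_lift_ob alg_lift_map alg_lift_id alg_lift_comp.

End AlgebraLifting.

(* For an adjunction L -| R and an inverse of [sigma : G L => L F], the mate
   F R => R L F R => R G L R => R G of that inverse. *)
Section Mate.
Variables (C D : category) (L : functor C D) (R : functor D C).
Variables (adj : adjunction L R) (F : functor C C) (G : functor D D).
Variables (sigma : nat_trans (G \O L) (L \O F)) (tau : nt_inverse sigma).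

Definition mate_map (X : D) : hom (F (R X)) (R (G X)) :=
  fmap R (fmap G (counit adj X)) \o fmap R (tau (R X)) \o unit adj (F (R X)).

Lemma mate_nat (X Y : D) (f : hom X Y) :
  mate_map Y \o fmap (F \O R) f = fmap (R \O G) f \o mate_map X.
Proof.
unfold mate_map; simpl.
assert (e1 := nt_nat (unit adj) (fmap F (fmap R f))); simpl in e1.
assert (e2 := nt_nat (nt_inv tau) (fmap R f)); simpl in e2.
assert (e3 := nt_nat (counit adj) f); simpl in e3.
rewrite <- comp_assoc, e1, !comp_assoc; f_equal.
rewrite <- !fmap_comp, <- comp_assoc, e2, comp_assoc; f_equal; f_equal.
now rewrite <- !fmap_comp, e3.
Qed.

Definition mate : nat_trans (F \O R) (R \O G) :=
  @NatTrans D C (F \O R) (R \O G) mate_map mate_nat.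

End Mate.

(* Main.v *)
(** After identifying [p \O star] with the identity functor, condition (1) says
that [Alg_p (star' X)] has the same algebra structure as [X].  By invertibility
of [sigma], the components of the original unit and counit are algebra morphisms;
naturality and the triangle identities then hold because they hold for the
underlying morphisms.  Left adjoints preserve initial objects. *)

From Stdlib Require Import FunctionalExtensionality ProofIrrelevance.
Require Import Defs.

Set Implicit Arguments.
Unset Strict Implicit.
Unset Printing Implicit Defensive.

Local Open Scope cat_scope.

(** Transport recast as a morphism, so that an equality of objects acts by composition instead of by
    casts on hom-types. *)
Definition hom_of_eq (C : category) (X Y : C) (e : X = Y) : hom X Y :=
  match e in _ = Z return hom X Z with eq_refl => idm X end.

Lemma functor_ext (C D : category) (F G : functor C D)
    (e : forall A : C, F A = G A) :
  (forall (A B : C) (f : hom A B),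
     hom_of_eq (e B) \o fmap F f = fmap G f \o hom_of_eq (e A)) ->
  F = G.
Proof.
destruct F as [F0 F1 Fid Fcomp], G as [G0 G1 Gid Gcomp]; simpl in *.
assert (e0 : F0 = G0) by (apply functional_extensionality; exact e).
subst G0; intro H.
assert (e1 : F1 = G1).
{ do 3 (apply functional_extensionality_dep; intro).
  generalize (H _ _ x1).
  (* With the object maps identified, the given equalities are loops; proof irrelevance makes them
     [eq_refl], so both [hom_of_eq] become identities. *)
  rewrite (proof_irrelevance _ (e x) eq_refl).
  rewrite (proof_irrelevance _ (e x0) eq_refl).
  simpl; now rewrite comp_idl, comp_idr. }
subst G1.
f_equal; apply proof_irrelevance.
Qed.

(** Algebras that differ only in a proof of equality of their actions share a carrier, so the
    transport in [functor_ext] is invisible on underlying morphisms. *)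
Lemma alg_map_hom_of_eq (C : category) (F : functor C C) (A : C)
    (a b : hom (F A) A) (e : a = b) :
  alg_map (@hom_of_eq (Alg F) _ _ (f_equal (@Algebra C F A) e)) = idm A.
Proof. now destruct e. Qed.

Section LiftComposition.
Variables (C D X : category).
Variables (F : functor C C) (G : functor D D) (N : functor X X).
Variables (H : functor C D) (K : functor D X).
Variables (theta : nat_trans (G \O H) (H \O F)).
Variables (kappa : nat_trans (N \O K) (K \O G)).

Lemma lift_comp_nat (A B : C) (f : hom A B) :
  fmap K (theta B) \o kappa (H B) \o fmap (N \O (K \O H)) f
  = fmap ((K \O H) \O F) f \o (fmap K (theta A) \o kappa (H A)).
Proof.
assert (e1 := nt_nat theta f); assert (e2 := nt_nat kappa (fmap H f)).
simpl in *.
rewrite <- comp_assoc, e2, !comp_assoc.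
now rewrite <- !fmap_comp, e1.
Qed.

(** The pasting of the two squares [theta] and [kappa]. *)
Definition lift_comp : nat_trans (N \O (K \O H)) ((K \O H) \O F) :=
  @NatTrans C X (N \O (K \O H)) ((K \O H) \O F)
    (fun A => fmap K (theta A) \o kappa (H A)) lift_comp_nat.

(** The two actions agree only up to functoriality of [K] and associativity, hence a propositional
    equality of functors. *)
Lemma alg_lift_fcomp : alg_lift kappa \O alg_lift theta = alg_lift lift_comp.
Proof.
assert (e : forall Y : Alg F,
  fmap K (fmap H (action Y) \o theta (carrier Y)) \o kappa (H (carrier Y))
  = fmap K (fmap H (action Y))
      \o (fmap K (theta (carrier Y)) \o kappa (H (carrier Y)))).
{ intro Y; now rewrite fmap_comp, comp_assoc. }
apply functor_ext
  with (e := fun Y => f_equal (@Algebra X N (K (H (carrier Y)))) (e Y)).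
intros Y Z f; apply alg_hom_eq.
change (alg_map (@hom_of_eq (Alg N) _ _ (f_equal (@Algebra X N _) (e Z)))
    \o fmap K (fmap H (alg_map f))
  = fmap K (fmap H (alg_map f))
    \o alg_map (@hom_of_eq (Alg N) _ _ (f_equal (@Algebra X N _) (e Y)))).
now rewrite !alg_map_hom_of_eq, comp_idl, comp_idr.
Qed.

End LiftComposition.

(* The equation [e] is reversed so that it can be eliminated on the variable [H]. *)
Lemma alg_lift_fid (C : category) (F H : functor C C) (e : fid C = H)
    (theta : nat_trans (F \O H) (H \O F)) :
  (forall A : C,
     nt_eq (eq_sym e) (F A) \o theta A \o fmap F (nt_eq e A) = idm (F A)) ->
  alg_lift theta = fid (Alg F).
Proof.
destruct e; simpl; intro h.
assert (h' : forall X : Alg F, action X \o theta (carrier X) = action X).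
{ intro X; generalize (h (carrier X)).
  rewrite fmap_id, comp_idl, comp_idr; intro t.
  now rewrite t, comp_idr. }
(* An abstract algebra is not convertible to [Algebra] of its action, so the object equality is
   built by matching on it. *)
apply functor_ext with (e := fun X : Alg F =>
  match X return alg_lift theta X = X with
  | Algebra a => f_equal (@Algebra C F _) (h' (Algebra a)) end).
intros [A a] [B b] f; apply alg_hom_eq.
change (alg_map (@hom_of_eq (Alg F) _ _
      (f_equal (@Algebra C F B) (h' (Algebra b)))) \o alg_map f
  = alg_map f \o alg_map (@hom_of_eq (Alg F) _ _
      (f_equal (@Algebra C F A) (h' (Algebra a))))).
now rewrite !alg_map_hom_of_eq, comp_idl, comp_idr.
Qed.

Section AdjunctionLifting.
Variables (C D : category) (L : functor C D) (R : functor D C).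
Variables (adj : adjunction L R) (F : functor C C) (G : functor D D).
Variables (sigma : nat_trans (G \O L) (L \O F)) (tau : nt_inverse sigma).

(** Sliding the unit past [tau] by naturality brings it next to the counit, where a triangle
    identity cancels the pair. *)
Lemma mate_unit (A : C) :
  mate adj tau (L A) \o fmap F (unit adj A)
  = fmap R (tau A) \o unit adj (F A).
Proof.
simpl; unfold mate_map; simpl.
assert (e1 := nt_nat (unit adj) (fmap F (unit adj A))); simpl in e1.
assert (e2 := nt_nat (nt_inv tau) (unit adj A)); simpl in e2.
assert (t := triangle_l adj A); simpl in t.
rewrite <- comp_assoc, e1, !comp_assoc, <- !fmap_comp.
rewrite <- (comp_assoc (fmap G _)), e2, comp_assoc, <- fmap_comp.
now rewrite t, fmap_id, comp_idl.
Qed.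

(** The mate is the transpose of the right-hand side; transposing back recovers it. *)
Lemma counit_mate (X : D) :
  counit adj (G X) \o fmap L (mate adj tau X)
  = fmap G (counit adj X) \o tau (R X).
Proof.
simpl; unfold mate_map; simpl.
assert (e := nt_nat (counit adj) (fmap G (counit adj X) \o tau (R X))).
simpl in e.
assert (t := triangle_l adj (F (R X))); simpl in t.
rewrite <- fmap_comp, fmap_comp, comp_assoc, e, <- comp_assoc.
now rewrite t, comp_idr.
Qed.

(** [mate_unit] leaves [sigma] directly after [tau]; they cancel, and naturality of the unit
    remains. *)
Lemma unit_action (X : Alg F) :
  unit adj (carrier X) \o action X
  = action (alg_lift (mate adj tau) (alg_lift sigma X))
      \o fmap F (unit adj (carrier X)).
Proof.
assert (e := nt_nat (unit adj) (action X)); simpl in e.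
assert (m := mate_unit (carrier X)); simpl in m.
assert (i := nt_inv_r tau (carrier X)); simpl in i.
simpl; rewrite <- comp_assoc, m, comp_assoc, <- fmap_comp, <- comp_assoc.
now rewrite i, comp_idr.
Qed.

(** Here [counit_mate] puts [tau] directly after [sigma], so the other inverse law is the one
    used. *)
Lemma counit_action (Y : Alg G) :
  counit adj (carrier Y)
    \o action (alg_lift sigma (alg_lift (mate adj tau) Y))
  = action Y \o fmap G (counit adj (carrier Y)).
Proof.
assert (e := nt_nat (counit adj) (action Y)); simpl in e.
assert (m := counit_mate (carrier Y)); simpl in m.
assert (i := nt_inv_l tau (R (carrier Y))); simpl in i.
simpl; rewrite fmap_comp, !comp_assoc, e.
rewrite <- (comp_assoc (action Y)), m, <- !comp_assoc.
now rewrite i, comp_idr.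
Qed.

Definition alg_unit :
    nat_trans (fid (Alg F)) (alg_lift (mate adj tau) \O alg_lift sigma).
Proof.
exists (fun X : Alg F =>
  @AlgHom C F X (alg_lift (mate adj tau) (alg_lift sigma X))
    (unit adj (carrier X)) (unit_action X)).
intros X Y f; apply alg_hom_eq; exact (nt_nat (unit adj) (alg_map f)).
Defined.

Definition alg_counit :
    nat_trans (alg_lift sigma \O alg_lift (mate adj tau)) (fid (Alg G)).
Proof.
exists (fun Y : Alg G =>
  @AlgHom D G (alg_lift sigma (alg_lift (mate adj tau) Y)) Y
    (counit adj (carrier Y)) (counit_action Y)).
intros X Y f; apply alg_hom_eq; exact (nt_nat (counit adj) (alg_map f)).
Defined.

(** Transparent, like [alg_unit] and [alg_counit], so that its unit and counit compute to the
    original ones on carriers. *)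
Definition alg_adjunction :
    adjunction (alg_lift sigma) (alg_lift (mate adj tau)).
Proof.
exists alg_unit alg_counit; intro X; apply alg_hom_eq.
- exact (triangle_l adj (carrier X)).
- exact (triangle_r adj (carrier X)).
Defined.

End AdjunctionLifting.

Lemma left_adjoint_initial (C D : category) (L : functor C D)
    (R : functor D C) (adj : adjunction L R) (M : C) :
  is_initial M -> is_initial (L M).
Proof.
intros hM Y; destruct (hM (R Y)) as [f hf].
exists (counit adj Y \o fmap L f); intro g.
assert (e := nt_nat (counit adj) g); simpl in e.
assert (t := triangle_l adj M); simpl in t.
(* Initiality of [M] identifies [f] with the transpose of [g]; transposing back then yields [g]. *)
rewrite <- (hf (fmap R g \o unit adj M)); simpl.
rewrite fmap_comp, comp_assoc, e.
now rewrite <- comp_assoc, t, comp_idr.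
Qed.

Theorem corollary9 (E B : category) (p : functor E B)
  (K : comprehension_with_section p)
  (F : functor B B) (G : functor E E)
  (delta : nat_trans (F \O p) (p \O G))
  (sigma : nat_trans (G \O star K) (star K \O F))
  (h1 : forall A : B,
     nt_eq (star_section K) (F A)
       \o fmap p (sigma A)
       \o delta (star K A)
       \o fmap F (nt_eq (eq_sym (star_section K)) A)
     = idm (F A))
  (sigma_inv : nt_inverse sigma) :
  let Alg_p : functor (Alg G) (Alg F) := alg_lift delta in
  let star' : functor (Alg F) (Alg G) := alg_lift sigma in
  let compr' : functor (Alg G) (Alg F) :=
    alg_lift (mate (star_compr_adj K) sigma_inv) in
  is_section Alg_p star'
  /\ (exists adj' : adjunction star' compr',
        (forall X : Alg F,
           alg_map (unit adj' X) = unit (star_compr_adj K) (carrier X))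
        /\ (forall Y : Alg G,
              alg_map (counit adj' Y)
              = counit (star_compr_adj K) (carrier Y)))
  /\ (forall M : Alg F, is_initial M -> is_initial (star' M)).
Proof.
intros Alg_p star' compr'.
pose (adj' := alg_adjunction (star_compr_adj K) sigma_inv).
split; [|split].
(* Merging both lifts into one along [p \O star K] lets the section equation replace that functor by
   the identity. *)
- unfold is_section, Alg_p, star'; rewrite alg_lift_fcomp.
  apply alg_lift_fid with (e := eq_sym (star_section K)); intro A.
  (* The condition required by [alg_lift_fid] is now [h1], up to a double symmetry and
     bracketing. *)
  rewrite eq_sym_involutive; simpl; rewrite !comp_assoc; exact (h1 A).
- now exists adj'.
- exact (left_adjoint_initial adj').
Qed.
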